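(* Let $\mathbb{T}^2=\partial\Omega_T\subset\mathbb{R}^3$ be the boundary of the standard solid torus $\Omega_T$, and let $\nu_{\mathbb{T}^2}(P)$ denote the interior unit normal to $\Omega_T$ at $P\in\mathbb{T}^2$. For $\delta>0$ let $E_\delta=\{n\in\mathbb{S}^2:|n\cdot e_3|<\delta\}$, where $e_3=(0,0,1)$. For any continuous field $C:\mathbb{T}^2\to\mathbb{S}^2$ satisfying $C(P)\cdot\nu_{\mathbb{T}^2}(P)>0$ for all $P\in\mathbb{T}^2$, there exists $\delta>0$ such that $E_\delta\subset C(\mathbb{T}^2)$. Conversely, for any given $\gamma>0$ there exists a continuous field $C_\gamma:\mathbb{T}^2\to\mathbb{S}^2$ satisfying $C_\gamma(P)\cdot\nu_{\mathbb{T}^2}(P)>0$ for all $P\in\mathbb{T}^2$ and such that $C_\gamma(\mathbb{T}^2)\subset E_\gamma$.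
   Context: The standard solid torus is $\Omega_T=T([0,2\pi]\times[0,2\pi]\times[0,1))$, where $T(\theta,\varphi,r)=(\cos\theta\,(2+r\cos\varphi),\ \sin\theta\,(2+r\cos\varphi),\ r\sin\varphi)$. Its boundary is $\mathbb{T}^2=\{(\cos\theta\,(2+\cos\varphi),\ \sin\theta\,(2+\cos\varphi),\ \sin\varphi):\theta,\varphi\in[0,2\pi]\}$. *)

(* Defs.v *)
From HB Require Import structures.
From mathcomp Require Import all_boot all_order all_algebra.
From mathcomp Require Import all_classical all_reals all_analysis.
From mathcomp Require Import ring lra.

Set Implicit Arguments.
Unset Strict Implicit.
Unset Printing Implicit Defensive.

Import Order.TTheory GRing.Theory Num.Theory.
Import numFieldNormedType.Exports.

Local Open Scope classical_set_scope.
Local Open Scope ring_scope.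

Section Defs.
Context {R : realType}.
Local Notation E3 := 'rV[R]_3.

Definition vec3 (x y z : R) : E3 := \row_i [:: x; y; z]`_i.

Definition dot (u v : E3) : R := \sum_i u ord0 i * v ord0 i.

Definition e3 : E3 := vec3 0 0 1.

Definition sphere : set E3 := [set n | dot n n = 1].

Definition band (delta : R) : set E3 := [set n | sphere n /\ `|dot n e3| < delta].

Definition torus_map (theta phi r : R) : E3 :=
  vec3 (cos theta * (2 + r * cos phi)) (sin theta * (2 + r * cos phi))
       (r * sin phi).

Definition solid_torus : set E3 :=
  [set torus_map u.1.1 u.1.2 u.2 |
     u in `[0, 2 * pi] `*` `[0, 2 * pi] `*` `[0, 1[].

Definition torus : set E3 :=
  [set torus_map u.1 u.2 1 | u in `[0, 2 * pi] `*` `[0, 2 * pi]].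

Definition boundary (A : set E3) : set E3 := closure A `\` interior A.

Definition tangent_to (S : set E3) (P v : E3) : Prop :=
  exists c : R -> E3,
    [/\ c 0 = P, \forall t \near (0 : R), S (c t) & is_derive (0 : R) 1 c v].

Definition is_interior_unit_normal (A : set E3) (P n : E3) : Prop :=
  [/\ dot n n = 1,
      forall v, tangent_to (boundary A) P v -> dot n v = 0
    & \forall t \near 0^'+, A (P + t *: n)].

(* The value is meaningful only where is_interior_unit_normal A P has exactly
   one solution; interior_unit_normal_torusE below shows that this is the case
   at every point of the torus. *)
Definition interior_unit_normal (A : set E3) (P : E3) : E3 :=
  xget 0 [set n | is_interior_unit_normal A P n].

End Defs.

Section Facts.
Context {R : realType}.
Local Notation E3 := 'rV[R]_3.
Implicit Types (P u v n : E3) (t f r : R).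

Lemma vec3E (x y z : R) : ((vec3 x y z ord0 0 = x) *
  (vec3 x y z ord0 1 = y) * (vec3 x y z ord0 2 = z))%type.
Proof. by rewrite /vec3 !mxE. Qed.

Lemma dotE u v :
  dot u v = u ord0 0 * v ord0 0 + u ord0 1 * v ord0 1 + u ord0 2 * v ord0 2.
Proof.
rewrite /dot !big_ord_recr big_ord0 /= add0r.
by congr (u _ _ * v _ _ + u _ _ * v _ _ + u _ _ * v _ _); apply/val_inj.
Qed.

Lemma eq_vec3 u v : u ord0 0 = v ord0 0 -> u ord0 1 = v ord0 1 ->
  u ord0 2 = v ord0 2 -> u = v.
Proof.
move=> h0 h1 h2; apply/rowP; case=> [[|[|[|//]]] Hi].
- by have -> : Ordinal Hi = 0 by apply/val_inj.
- by have -> : Ordinal Hi = 1 by apply/val_inj.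
- by have -> : Ordinal Hi = 2 by apply/val_inj.
Qed.

Lemma polar_angle (a b : R) : a ^+ 2 + b ^+ 2 = 1 ->
  exists2 t, t \in `[0, 2 * pi] & a = cos t /\ b = sin t.
Proof.
move=> ab; have a1 : -1 <= a <= 1 by apply/andP; split; nra.
have p0 := @pi_ge0 R.
have ha0 := acos_ge0 a1; have hap := acos_lepi a1.
have ca : cos (acos a) = a by apply: acosK; rewrite in_itv.
have sa : sin (acos a) = `|b|.
  rewrite sin_acos// (_ : 1 - a ^+ 2 = b ^+ 2) ?sqrtr_sqr//; lra.
have [b0|b0] := leP 0 b.
  exists (acos a); first by rewrite in_itv /=; apply/andP; split; lra.
  by rewrite ca sa ger0_norm.
exists (2 * pi - acos a); first by rewrite in_itv /=; apply/andP; split; lra.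
have -> : 2 * pi - acos a = - acos a + pi *+ 2 :> R by rewrite mulr2n; ring.
by rewrite cosD2pi sinD2pi cosN sinN ca sa ltr0_norm// opprK.
Qed.

(* Squared distance to the core circle of radius 2. *)
Definition core_dist2 P : R :=
  (Num.sqrt (P ord0 0 ^+ 2 + P ord0 1 ^+ 2) - 2) ^+ 2 + P ord0 2 ^+ 2.

Lemma core_dist2_map t f r : `|r| <= 2 ->
  core_dist2 (torus_map t f r) = r ^+ 2.
Proof.
move=> r2; rewrite /core_dist2 /torus_map !vec3E.
have -> : (cos t * (2 + r * cos f)) ^+ 2 + (sin t * (2 + r * cos f)) ^+ 2
     = (2 + r * cos f) ^+ 2.
  by rewrite !exprMn -mulrDl cos2Dsin2 mul1r.
rewrite sqrtr_sqr ger0_norm; last first.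
  have := ler_pM (normr_ge0 r) (normr_ge0 (cos f)) r2 (cos_max f).
  rewrite -normrM ler_norml => /andP[]; lra.
have := cos2Dsin2 f; nra.
Qed.

Lemma core_dist2_inv P r : 0 <= r <= 1 -> core_dist2 P = r ^+ 2 ->
  exists t f, [/\ t \in `[0, 2 * pi], f \in `[0, 2 * pi] & P = torus_map t f r].
Proof.
move=> /andP[r0 r1]; rewrite /core_dist2.
set rho := Num.sqrt _ => hP.
have rho0 : 0 <= rho by exact: sqrtr_ge0.
have rho2 : rho ^+ 2 = P ord0 0 ^+ 2 + P ord0 1 ^+ 2.
  by rewrite sqr_sqrtr// addr_ge0 ?sqr_ge0.
have rho_gt0 : 0 < rho.
  by have := sqr_ge0 (P ord0 2); nra.
have rhoN0 : rho != 0 by rewrite gt_eqF.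
have [|t tI [ct st]] := @polar_angle (P ord0 0 / rho) (P ord0 1 / rho).
  by rewrite !expr_div_n -mulrDl -rho2 divff// expf_neq0.
have [f [fI cf sf]] : exists f,
    [/\ f \in `[0, 2 * pi], rho - 2 = r * cos f & P ord0 2 = r * sin f].
  have [r00|rN0] := eqVneq r 0.
    exists 0; split; first by rewrite in_itv /= lexx /=; have := @pi_ge0 R; lra.
      rewrite r00; move: hP; rewrite r00; have := sqr_ge0 (P ord0 2); nra.
    rewrite r00; move: hP; rewrite r00; have := sqr_ge0 (rho - 2); nra.
  have [|f fI [cf sf]] := @polar_angle ((rho - 2) / r) (P ord0 2 / r).
    by rewrite !expr_div_n -mulrDl hP divff// expf_neq0.
  by exists f; split=> //; rewrite -?cf -?sf mulrC divfK.
exists t, f; split=> //; rewrite /torus_map -cf -sf -ct -st.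
by apply: eq_vec3; rewrite !vec3E// addrC subrK divfK.
Qed.

Lemma solid_torusE : solid_torus = [set P | core_dist2 P < 1].
Proof.
apply/seteqP; split=> [P|P] /=.
  move=> [[[t f] r]] /= [_ ]; rewrite in_itv /= => /andP[r0 r1] <-.
  by rewrite core_dist2_map ?ger0_norm//; nra.
move=> h1; have h0 : 0 <= core_dist2 P by rewrite addr_ge0 ?sqr_ge0.
have [||t [f [tI fI PE]]] := @core_dist2_inv P (Num.sqrt (core_dist2 P)).
- by rewrite sqrtr_ge0 /= -sqrtr1 ler_sqrt// ltW.
- by rewrite sqr_sqrtr.
exists ((t, f), Num.sqrt (core_dist2 P)) => //=; split; first by split.
by rewrite in_itv /= sqrtr_ge0 /= -[ltRHS]sqrtr1 ltr_sqrt.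
Qed.

Lemma torusE : torus = [set P | core_dist2 P = 1].
Proof.
apply/seteqP; split=> [P|P] /=.
  by move=> [[t f] _ <-]; rewrite core_dist2_map ?expr1n// normr1 ler1n.
move=> h1; have [||t [f [tI fI ->]]] := @core_dist2_inv P 1.
- by rewrite ler01 lexx.
- by rewrite expr1n.
by exists (t, f).
Qed.

Lemma torus_map_radial t f r s : torus_map t f r +
  s *: - vec3 (cos t * cos f) (sin t * cos f) (sin f) = torus_map t f (r - s).
Proof. by apply: eq_vec3; rewrite !mxE /=; ring. Qed.

Lemma coord_cvg P i j : (fun Q : E3 => Q i j) @ P --> P i j.
Proof. exact: coord_continuous. Qed.

Lemma core_dist2_cvg (F : set_system E3) (FF : Filter F) P :
  (forall i, (fun Q : E3 => Q ord0 i) @ F --> P ord0 i) ->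
  core_dist2 @ F --> core_dist2 P.
Proof.
move=> PF.
have sqr_cvg (g : E3 -> R) (a : R) :
    g @ F --> a -> (fun Q => g Q ^+ 2) @ F --> a ^+ 2.
  by move=> ga; exact: (cvgM ga ga).
have c2 : (fun Q => Q ord0 0 ^+ 2 + Q ord0 1 ^+ 2) @ F -->
    P ord0 0 ^+ 2 + P ord0 1 ^+ 2.
  by apply: cvgD; apply: sqr_cvg; exact: PF.
have cs : (fun Q => Num.sqrt (Q ord0 0 ^+ 2 + Q ord0 1 ^+ 2)) @ F -->
    Num.sqrt (P ord0 0 ^+ 2 + P ord0 1 ^+ 2).
  exact: (cvg_comp _ _ c2 (@sqrt_continuous R _)).
apply: cvgD; apply: sqr_cvg; last exact: PF.
by apply: cvgB => //; exact: cvg_cst.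
Qed.

Lemma core_dist2_continuous : continuous core_dist2.
Proof.
move=> P; apply: (@core_dist2_cvg (nbhs P) (nbhs_filter P)) => i.
exact: coord_cvg.
Qed.

Lemma boundary_solid_torus : boundary (@solid_torus R) = torus.
Proof.
have op : open (@solid_torus R).
  rewrite solid_torusE (_ : [set _ | _] = core_dist2 @^-1` [set x | x < 1])//.
  apply: open_comp; last exact: open_lt.
  by move=> x _; exact: core_dist2_continuous.
have cl : closed [set P | core_dist2 P <= 1].
  rewrite (_ : [set _ | _] = core_dist2 @^-1` [set x | x <= 1])//.
  apply: preimage_closed; last exact: closed_le.
  by move=> x _; exact: core_dist2_continuous.
rewrite /boundary (interior_id _).1//.
apply/seteqP; split=> [P [clP]|P TP].
  rewrite solid_torusE torusE /= => /negP; rewrite -leNgt => ge1.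
  apply/eqP; rewrite eq_le ge1 andbT.
  have /closure_id clE := cl.
  suff : closure [set P | core_dist2 P <= 1] P by rewrite -clE.
  apply: closureS clP => Q; rewrite solid_torusE /=; exact: ltW.
split; last by move: TP; rewrite solid_torusE torusE /= => ->; rewrite ltxx.
case: TP => -[t f] /= [tI fI] <- B nB.
set w := - vec3 (cos t * cos f) (sin t * cos f) (sin f).
have lim : (fun s : R => torus_map t f 1 + s *: w) @ 0^'+ --> torus_map t f 1.
  apply: cvg_at_right_filter.
  have zw : (fun s : R => s *: w) @ (0 : R) --> 0 *: w by exact: scalel_continuous.
  have := cvgD (cvg_cst (torus_map t f 1)) zw.
  by rewrite scale0r addr0; apply.
have nearB : \forall s \near 0^'+, B (torus_map t f 1 + s *: w) by exact: lim.
have [s [Bs s0 s1]] : exists s, [/\ B (torus_map t f 1 + s *: w), 0 < s & s < 1].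
  apply: (@filter_ex _ (at_right (0 : R))).
  near=> s; split; [by near: s|by near: s; exact: nbhs_right_gt|].
  by near: s; exact: nbhs_right_lt.
exists (torus_map t f 1 + s *: w); split=> //.
rewrite solid_torusE /= torus_map_radial core_dist2_map.
  by rewrite expr_lt1//; lra.
by rewrite ger0_norm; lra.
Unshelve. all: by end_near.
Qed.

Lemma is_derive_coord (c : R -> E3) v (i : 'I_3) : is_derive (0 : R) 1 c v ->
  is_derive (0 : R) 1 (fun s => c s ord0 i) (v ord0 i).
Proof.
move=> [dc vE]; have /derivable_mxP dci := dc.
by apply: DeriveDef; [exact: dci|rewrite -vE derive_mx// mxE].
Qed.

Lemma is_derive_vec3 (x y z : R -> R) (dx dy dz : R) :
  is_derive (0 : R) 1 x dx -> is_derive (0 : R) 1 y dy ->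
  is_derive (0 : R) 1 z dz ->
  is_derive (0 : R) 1 (fun s => vec3 (x s) (y s) (z s)) (vec3 dx dy dz).
Proof.
move=> [hx xE] [hy yE] [hz zE].
have coordE (u : 'I_1) (i : 'I_3) :
    (fun s => vec3 (x s) (y s) (z s) u i) = nth x [:: x; y; z] i.
  by apply/funext => s; rewrite /vec3 mxE; case: i => [[|[|[|//]]]].
have dc : derivable (fun s => vec3 (x s) (y s) (z s)) (0 : R) 1.
  apply/derivable_mxP => u i; rewrite coordE.
  case: i => [[|[|[|i]]]] hi; [exact: hx|exact: hy|exact: hz|discriminate hi].
apply: DeriveDef => //; rewrite derive_mx//; apply/matrixP => u i.
rewrite [LHS]mxE coordE /vec3 mxE.
by case: i => [[|[|[|//]]]] /=.
Qed.

Lemma torus_map_torus t f : torus (torus_map t f 1).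
Proof. by rewrite torusE /= core_dist2_map ?expr1n// normr1 ler1n. Qed.

Lemma tangent_torus_theta t f : tangent_to torus (torus_map t f 1)
  (vec3 (- sin t * (2 + cos f)) (cos t * (2 + cos f)) 0).
Proof.
exists (fun s => torus_map (t + s) f 1); split; first by rewrite addr0.
  by exists 1 => //= s _; exact: torus_map_torus.
rewrite /torus_map; apply: is_derive_vec3.
- by apply: is_derive_eq; rewrite /GRing.scale /= !addr0; ring.
- by apply: is_derive_eq; rewrite /GRing.scale /= !addr0; ring.
Qed.

Lemma tangent_torus_phi t f : tangent_to torus (torus_map t f 1)
  (vec3 (- cos t * sin f) (- sin t * sin f) (cos f)).
Proof.
exists (fun s => torus_map t (f + s) 1); split; first by rewrite addr0.
  by exists 1 => //= s _; exact: torus_map_torus.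
rewrite /torus_map; apply: is_derive_vec3;
  by apply: is_derive_eq; rewrite /GRing.scale /= !addr0; ring.
Qed.

Lemma torus_quartic P : torus P ->
  (P ord0 0 ^+ 2 + P ord0 1 ^+ 2 + P ord0 2 ^+ 2 + 3) ^+ 2
    - 16 * (P ord0 0 ^+ 2 + P ord0 1 ^+ 2) = 0.
Proof.
move=> [[t f] _ <-]; rewrite /torus_map !vec3E /= !mul1r.
have h : (cos t * (2 + cos f)) ^+ 2 + (sin t * (2 + cos f)) ^+ 2
     = (2 + cos f) ^+ 2 by rewrite !exprMn -mulrDl cos2Dsin2 mul1r.
by rewrite h sin2cos2; ring.
Qed.

Lemma tangent_torus_dot t f v : tangent_to torus (torus_map t f 1) v ->
  dot (vec3 (cos t * cos f) (sin t * cos f) (sin f)) v = 0.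
Proof.
move=> [c [c0 cT dc]].
have dx := is_derive_coord 0 dc.
have dy := is_derive_coord 1 dc.
have dz := is_derive_coord 2 dc.
pose x s := c s ord0 0; pose y s := c s ord0 1; pose z s := c s ord0 2.
rewrite -/x in dx; rewrite -/y in dy; rewrite -/z in dz.
pose q : R -> R := (x ^+ 2 + y ^+ 2 + z ^+ 2 + cst 3) ^+ 2
                   - cst 16 * (x ^+ 2 + y ^+ 2).
have q1 : is_derive (0 : R) 1 q
   (4 * (x 0 ^+ 2 + y 0 ^+ 2 + z 0 ^+ 2 + 3)
      * (x 0 * v ord0 0 + y 0 * v ord0 1 + z 0 * v ord0 2)
    - 32 * (x 0 * v ord0 0 + y 0 * v ord0 1)).
  have xy := is_deriveD (is_deriveX 2 dx) (is_deriveX 2 dy).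
  have xyz := is_deriveD xy (is_deriveX 2 dz).
  have xyz3 := is_deriveD xyz (is_derive_cst (3 : R) (0 : R) (1 : R)).
  have cxy := is_deriveM (is_derive_cst (16 : R) (0 : R) (1 : R)) xy.
  have qq := is_deriveB (is_deriveX 2 xyz3) cxy.
  apply: (@is_derive_eq _ _ _ _ _ _ _ _ qq); rewrite /GRing.scale /=.
  have -> : (x ^+ 2 + y ^+ 2 + z ^+ 2 + cst 3) 0 =
    x 0 ^+ 2 + y 0 ^+ 2 + z 0 ^+ 2 + 3 by [].
  by ring.
have q0 : is_derive (0 : R) 1 q 0.
  apply: (@near_eq_is_derive _ _ _ (cst (0 : R) : R -> R)).
  near=> s; have /torus_quartic : torus (c s) by near: s.
  by move=> h; rewrite -[LHS]h.
have := @derive_val _ _ _ _ _ _ _ q0; rewrite (@derive_val _ _ _ _ _ _ _ q1).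
rewrite /x /y /z c0 /torus_map !vec3E dotE !vec3E !mul1r.
have -> : (cos t * (2 + cos f)) ^+ 2 + (sin t * (2 + cos f)) ^+ 2
     = (2 + cos f) ^+ 2 by rewrite !exprMn -mulrDl cos2Dsin2 mul1r.
have -> : (2 + cos f) ^+ 2 + sin f ^+ 2 + 3 = 4 * (2 + cos f).
  by rewrite sin2cos2; ring.
set X := v ord0 0; set Y := v ord0 1; set Z := v ord0 2 => h.
have cN0 : 16 * (2 + cos f) != 0 by have := cos_geN1 f; lra.
apply: (mulfI cN0); rewrite mulr0 -h; ring.
Unshelve. all: by end_near.
Qed.

Lemma interior_unit_normal_torus t f n :
  is_interior_unit_normal solid_torus (torus_map t f 1) n <->
  n = - vec3 (cos t * cos f) (sin t * cos f) (sin f).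
Proof.
have T1 := cos2Dsin2 t; have F1 := cos2Dsin2 f.
rewrite /is_interior_unit_normal boundary_solid_torus; split=> [[n1 nT nin]|->].
  have := nT _ (tangent_torus_theta t f); have := nT _ (tangent_torus_phi t f).
  move: n1; rewrite !dotE !vec3E.
  set x := n ord0 0; set y := n ord0 1; set z := n ord0 2 => n1 nphi nth.
  have {}nth : y * cos t - x * sin t = 0.
    have c0 : 2 + cos f != 0 by have := cos_geN1 f; lra.
    by apply: (mulIf c0); rewrite mul0r -nth; ring.
  pose a := x * cos t + y * sin t.
  have xE : x = a * cos t.
    transitivity (x * (cos t ^+ 2 + sin t ^+ 2)); first by rewrite T1 mulr1.
    transitivity (a * cos t - (y * cos t - x * sin t) * sin t); rewrite /a; first ring.
    by rewrite nth mul0r subr0.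
  have yE : y = a * sin t.
    transitivity (y * (cos t ^+ 2 + sin t ^+ 2)); first by rewrite T1 mulr1.
    transitivity (a * sin t + (y * cos t - x * sin t) * cos t); rewrite /a; first ring.
    by rewrite nth mul0r addr0.
  have {}nphi : z * cos f - a * sin f = 0 by rewrite -nphi /a; ring.
  pose b := a * cos f + z * sin f.
  have aE : a = b * cos f.
    transitivity (a * (cos f ^+ 2 + sin f ^+ 2)); first by rewrite F1 mulr1.
    transitivity (b * cos f - (z * cos f - a * sin f) * sin f); rewrite /b; first ring.
    by rewrite nphi mul0r subr0.
  have zE : z = b * sin f.
    transitivity (z * (cos f ^+ 2 + sin f ^+ 2)); first by rewrite F1 mulr1.
    transitivity (b * sin f + (z * cos f - a * sin f) * cos f); rewrite /b; first ring.
    by rewrite nphi mul0r addr0.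
  have nE : n = (- b) *: - vec3 (cos t * cos f) (sin t * cos f) (sin f).
    apply: eq_vec3; rewrite !mxE /= -/x -/y -/z ?xE ?yE ?zE ?aE; ring.
  have : b ^+ 2 = 1.
    rewrite -n1 xE yE zE aE.
    transitivity (b ^+ 2 * (cos f ^+ 2 * (cos t ^+ 2 + sin t ^+ 2) + sin f ^+ 2)).
      by rewrite T1 mulr1 F1 mulr1.
    ring.
  move=> /eqP; rewrite sqrf_eq1 => /orP[/eqP b1|/eqP b1]; last first.
    by rewrite nE b1 opprK scale1r.
  have [s [inA s0 s1]] : exists s,
      [/\ solid_torus (torus_map t f 1 + s *: n), 0 < s & s < 1].
    apply: (@filter_ex _ (at_right (0 : R))).
    near=> s; split; [by near: s|by near: s; exact: nbhs_right_gt|].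
    by near: s; exact: nbhs_right_lt.
  exfalso; move: inA; rewrite solid_torusE /= nE b1 scalerA mulrN1 torus_map_radial.
  by rewrite core_dist2_map ?ger0_norm; nra.
split.
- rewrite dotE !mxE /=.
  transitivity (cos f ^+ 2 * (cos t ^+ 2 + sin t ^+ 2) + sin f ^+ 2); first ring.
  by rewrite T1 mulr1.
- move=> v /tangent_torus_dot; rewrite !dotE !mxE /= => h.
  by rewrite !mulNr -!opprD h oppr0.
- near=> s; rewrite torus_map_radial solid_torusE /=.
  have s0 : 0 < s by near: s; exact: nbhs_right_gt.
  have s1 : s < 1 by near: s; exact: nbhs_right_lt.
  by rewrite core_dist2_map ?ger0_norm; nra.
Unshelve. all: by end_near.
Qed.

Lemma interior_unit_normal_torusE t f :
  interior_unit_normal solid_torus (torus_map t f 1) =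
  - vec3 (cos t * cos f) (sin t * cos f) (sin f).
Proof.
by apply: xget_unique => [|n]; rewrite /= interior_unit_normal_torus.
Qed.

End Facts.

(* Main.v *)
(* On the inner half of the torus the normal is
     nu = (cos t cos f, sin t cos f, sin f),  |f| <= pi/2
   (f is measured from the inner equator), so C.e3 is negative on the circle
   f = -pi/2 and positive on f = pi/2. Let d > 0 be the minimum of C.nu, take
   n = (s cos al, s sin al, n3) with |n3| < d, and look at the rectangle
   |t - al| <= pi/2, |f| <= pi/2. With
   u = (-sin al, cos al, 0) one has nu = -/+ cos f u + sin f e3 on the two sides
   t = al -/+ pi/2, so the functions
     F = C.e3 - n3   and   G = cos f (C.u) + sin(t - al) sin f F
   satisfy the sign conditions of the two-dimensional Poincare-Miranda theorem.
   A common zero gives C.e3 = n3 and C.u = 0, whence C = n by C.nu > 0. The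
   Poincare-Miranda theorem itself comes from a Sperner-type parity argument on
   grids and compactness.

   Conversely, with f the usual angle, let the horizontal part of the field turn
   through the longitudinal direction: with a^2 + b^2 = 1 and
   0 < b < gamma the unit field
     - cos f e_r + a sin f e_t - b sin f e3
   has scalar product cos^2 f + b sin^2 f with the interior normal. *)

Require Import Defs.
From HB Require Import structures.
From mathcomp Require Import all_boot all_order all_algebra.
From mathcomp Require Import all_classical all_reals all_analysis.
From mathcomp Require Import ring lra.

Set Implicit Arguments.
Unset Strict Implicit.
Unset Printing Implicit Defensive.

Import Order.TTheory GRing.Theory Num.Theory.
Import numFieldNormedType.Exports.

Local Open Scope classical_set_scope.
Local Open Scope ring_scope.

(** * Sperner-type parity on a grid *)

Definition cell (i j : nat) : seq (nat * nat) :=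
  [:: (i, j); (i.+1, j); (i.+1, j.+1); (i, j.+1)].

(** If no such cell existed, the number of 01 edges in row [j], plus one when [p (N, j)], would keep
    its parity from row to row; it is odd at the bottom and even at the top. *)
Lemma grid_sign_change (N : nat) (p q : nat * nat -> bool) :
  (forall i, (i <= N)%N -> p (i, 0%N)) ->
  (forall i, (i <= N)%N -> ~~ p (i, N)) ->
  (forall j, (j <= N)%N -> q (0%N, j)) ->
  (forall j, (j <= N)%N -> ~~ q (N, j)) ->
  exists i j, [/\ (i < N)%N, (j < N)%N,
    forall b, exists2 u, u \in cell i j & p u = b &
    forall b, exists2 u, u \in cell i j & q u = b].
Proof.
move=> pbot ptop qleft qright; apply: contrapT => noC.
(* Colour a vertex 0 if p, 1 if ~~ p and ~~ q, 2 if ~~ p and q. A cell missing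
   one of the colours has an even number of sides coloured 01. *)
pose c01 u v := [&& p u, ~~ p v & ~~ q v] || [&& p v, ~~ p u & ~~ q u].
have cell_even i j : (i < N)%N -> (j < N)%N ->
    c01 (i, j) (i.+1, j) (+) c01 (i, j.+1) (i.+1, j.+1) =
    c01 (i, j) (i, j.+1) (+) c01 (i.+1, j) (i.+1, j.+1).
  move=> iN jN.
  have mixed (g : nat * nat -> bool) : ~~ constant (map g (cell i j)) ->
      forall b, exists2 u, u \in cell i j & g u = b.
    have memC k : (k < 4)%N -> nth (0, 0)%N (cell i j) k \in cell i j.
      by move=> k4; exact: mem_nth.
    have := (memC 0 isT, memC 1 isT, memC 2 isT, memC 3 isT)%N.
    rewrite /=; move: (cell i j) => C -[[[m0 m1] m2] m3] ncst b.
    have [gb|/eqP gb0] := eqVneq (g (i, j)) b; first by exists (i, j).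
    have [gb|/eqP gb1] := eqVneq (g (i.+1, j)) b; first by exists (i.+1, j).
    have [gb|/eqP gb2] := eqVneq (g (i.+1, j.+1)) b; first by exists (i.+1, j.+1).
    have [gb|/eqP gb3] := eqVneq (g (i, j.+1)) b; first by exists (i, j.+1).
    by move: ncst gb0 gb1 gb2 gb3 => /=; do 4 case: (g _); case: b.
  (* [noC] forbids both [p] and [q] to vary on a cell, and a constant [p] or [q] rules out one of
     the colours. *)
  have : constant (map p (cell i j)) \/ constant (map q (cell i j)).
    apply: contrapT => /not_orP[/negP/mixed mp /negP/mixed mq].
    by apply: noC; exists i, j; split.
  rewrite /c01 /=; move: (p _) (p _) (p _) (p _) (q _) (q _) (q _) (q _).
  by do 8 case; case.
pose S k j := \big[addb/false]_(i < k) c01 (val i, j) (i.+1, j).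
have rowE j k : (j < N)%N -> (k <= N)%N ->
    S k j (+) S k j.+1 = c01 (0, j)%N (0, j.+1)%N (+) c01 (k, j) (k, j.+1).
  move=> jN; elim: k => [|k IH] kN; first by rewrite /S !big_ord0 !addbb.
  rewrite /S !big_ord_recr /= addbACA -!/(S _ _) (IH (ltnW kN)) (cell_even _ _ kN jN).
  by rewrite -!addbA; congr (_ (+) _); rewrite addbA addbb.
(* The left side has no vertex of colour 1, hence no 01 edge; the right side has only colours 0 and
   1, so its 01 edges are the changes of [p]. *)
have inv j : (j <= N)%N -> S N j (+) p (N, j).
  elim: j => [|j IH] jN.
    rewrite pbot// /S big1// => i _.
    by rewrite /c01 (pbot _ (ltn_ord i)) (pbot _ (ltnW (ltn_ord i))).
  have := IH (ltnW jN); have := rowE j N jN (leqnn N).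
  rewrite /c01 (qleft _ jN) (qleft _ (ltnW jN)) (negbTE (qright _ jN)).
  rewrite (negbTE (qright _ (ltnW jN))) !andbF /= !andbT.
  by case: (S N j); case: (S N j.+1); case: (p _); case: (p _).
have := inv N (leqnn N); rewrite (negbTE (ptop _ (leqnn N))) /S big1// => i _.
by rewrite /c01 (negbTE (ptop _ (ltn_ord i))) (negbTE (ptop _ (ltnW (ltn_ord i)))).
Qed.

(** * The two-dimensional Poincare-Miranda theorem *)

Section PoincareMiranda.
Context {R : realType}.

(** Every neighbourhood of [P] contains points with [H] negative and points with [H] nonnegative, so
    continuity excludes both strict signs at [P]. *)
Lemma cluster_sign_change (V : pseudoMetricNormedZmodType R) (H : V -> R)
    (X : nat -> V) (P : V) :
  {for P, continuous H} -> cluster (X @ \oo) P ->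
  (forall n b, exists2 u, `|u - X n| <= n.+1%:R^-1 & (H u < 0) = b) ->
  H P = 0.
Proof.
move=> Hc clP sgn.
have key (A : set R) : nbhs (H P) A -> exists2 u, A (H u) & (H u < 0) = ~~ (H P < 0).
  move=> /Hc/nbhs_normP[e /= e0 eA].
  have [M _ Me] := near_infty_natSinv_lt (PosNum (divr_gt0 e0 (ltr0Sn R 1))).
  have [||Y [[n /= Mn <-] XnP]] := clP (X @` [set n | (M <= n)%N]) [set Y | `|P - Y| < e / 2].
  - by exists M => // n /= Mn; exists n.
  - by apply/nbhs_normP; exists (e / 2); rewrite //= divr_gt0.
  have [u uX ub] := sgn n (~~ (H P < 0)); exists u => //.
  apply: eA => /=; rewrite (splitr e) -(subrKA (X n)).
  rewrite (le_lt_trans (ler_normD _ _))// ltrD//.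
  by rewrite distrC (le_lt_trans uX)//; exact: Me.
apply/eqP; case: (ltgtP (H P) 0) => // HP.
  have [|u /= uA] := key [set x | x < 0]; first exact: lt_nbhsl.
  by rewrite HP uA.
have [|u /= uA] := key [set x | x > 0]; first exact: lt_nbhsr.
by rewrite (lt_gtF HP) (lt_gtF uA).
Qed.

(** By compactness of the square, the cells found on finer and finer grids cluster at a point, and
    there both functions vanish. *)
Lemma poincare_miranda2 (F G : R * R -> R) :
  continuous F -> continuous G ->
  (forall x : R, 0 <= x <= 1 -> F (x, 0) < 0) ->
  (forall x : R, 0 <= x <= 1 -> 0 < F (x, 1)) ->
  (forall y : R, 0 <= y <= 1 -> G (0, y) < 0) ->
  (forall y : R, 0 <= y <= 1 -> 0 < G (1, y)) ->
  exists P, [/\ 0 <= P.1 <= 1, 0 <= P.2 <= 1, F P = 0 & G P = 0].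
Proof.
move=> cF cG Fbot Ftop Gleft Gright.
pose pt n (u : nat * nat) : R * R := (u.1%:R / n.+1%:R, u.2%:R / n.+1%:R).
have pt01 n i : (i <= n.+1)%N -> 0 <= (i%:R / n.+1%:R : R) <= 1.
  by move=> ni; rewrite divr_ge0//= ler_pdivrMr// mul1r ler_nat.
have /choice[X XP] n : exists P : R * R, [/\ 0 <= P.1 <= 1, 0 <= P.2 <= 1,
    forall b, exists2 u, `|u - P| <= n.+1%:R^-1 & (F u < 0) = b &
    forall b, exists2 u, `|u - P| <= n.+1%:R^-1 & (G u < 0) = b].
  have [||||i [j [iN jN Fsgn Gsgn]]] := @grid_sign_change n.+1
      (fun u => F (pt n u) < 0) (fun u => G (pt n u) < 0).
  - by move=> i iN; rewrite /pt /= mul0r Fbot// pt01.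
  - by move=> i iN; rewrite /pt /= divff// -leNgt ltW// Ftop// pt01.
  - by move=> j jN; rewrite /pt /= mul0r Gleft// pt01.
  - by move=> j jN; rewrite /pt /= divff// -leNgt ltW// Gright// pt01.
  (* The product carries the max norm, so the diagonal of a cell is no longer than its sides. *)
  have near_cell u : u \in cell i j -> `|pt n u - pt n (i, j)| <= n.+1%:R^-1.
    have stepE k : k.+1%:R / n.+1%:R - k%:R / n.+1%:R = n.+1%:R^-1 :> R.
      by rewrite -mulrBl -natrB// subSnn mul1r.
    have n0 : 0 <= n.+1%:R^-1 :> R by rewrite invr_ge0.
    rewrite !inE => /or4P[] /eqP->; rewrite prod_normE /= ge_max ?stepE ?subrr;
      by rewrite ?normr0 ?ger0_norm ?n0 ?lexx.
  exists (pt n (i, j)); split; [exact: pt01 (ltnW iN)|exact: pt01 (ltnW jN)| |].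
  - by move=> b; have [u /near_cell uC ub] := Fsgn b; exists (pt n u).
  - by move=> b; have [u /near_cell uC ub] := Gsgn b; exists (pt n u).
have [] := compact_setX (@segment_compact R 0 1) (@segment_compact R 0 1)
    (F := X @ \oo).
  by exists 0%N => // n _; have [] := XP n; rewrite /= !in_itv.
move=> P [] [] /=; rewrite !in_itv /= => P1 P2 clP; exists P; split=> //.
- by apply: (cluster_sign_change (cF P) clP) => n b; have [] := XP n.
- by apply: (cluster_sign_change (cG P) clP) => n b; have [] := XP n.
Qed.

End PoincareMiranda.

(** * Continuity on the torus and the normal *)

Section TorusFields.
Context {R : realType}.
Local Notation E3 := 'rV[R]_3.
Implicit Types (C : E3 -> E3) (P : E3).

Lemma cvg_vec3 (T : Type) (F : set_system T) (FF : Filter F)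
    (f g h : T -> R) (a b c : R) :
  f @ F --> a -> g @ F --> b -> h @ F --> c ->
  (fun x => vec3 (f x) (g x) (h x)) @ F --> vec3 a b c.
Proof.
have vec3_lin (x y z : R) :
    vec3 x y z = x *: vec3 1 0 0 + y *: vec3 0 1 0 + z *: vec3 0 0 1.
  by apply: eq_vec3; rewrite !mxE /=; ring.
move=> fa gb hc; rewrite vec3_lin (funext (fun x => vec3_lin (f x) (g x) (h x))).
by apply: cvgD; [apply: cvgD|]; apply: cvgZr_tmp.
Qed.

Lemma continuous_comp_fst (T U V : topologicalType) (g : T -> V) :
  continuous g -> continuous (fun u : T * U => g u.1).
Proof. by move=> cg u; apply: (continuous_comp _ (cg _)); exact: cvg_fst. Qed.

Lemma continuous_comp_snd (T U V : topologicalType) (g : U -> V) :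
  continuous g -> continuous (fun u : T * U => g u.2).
Proof. by move=> cg u; apply: (continuous_comp _ (cg _)); exact: cvg_snd. Qed.

Lemma continuous_map_pair (S T U V : topologicalType) (f : S -> U) (g : T -> V) :
  continuous f -> continuous g ->
  continuous (fun u : S * T => (f u.1, g u.2) : U * V).
Proof.
move=> cf cg u.
by apply: cvg_pair; [exact: continuous_comp_fst|exact: continuous_comp_snd].
Qed.

Lemma continuous_torus_map : continuous (fun u : R * R => torus_map u.1 u.2 1).
Proof.
have [cs sn] := (@continuous_cos R, @continuous_sin R) => u.
have r_cvg : (fun v : R * R => 2 + 1 * cos v.2) @ u --> 2 + 1 * cos u.2.
  apply: cvgD; first exact: cvg_cst.
  by apply: cvgM; [exact: cvg_cst|exact: continuous_comp_snd].
apply: cvg_vec3; apply: cvgM => //.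
- exact: continuous_comp_fst.
- exact: continuous_comp_fst.
- exact: cvg_cst.
- exact: continuous_comp_snd.
Qed.

(** With the torus parametrization as [h], a field continuous only relative to the torus becomes
    continuous in the angles. *)
Lemma continuous_comp_within (T U V : topologicalType) (A : set U)
    (h : T -> U) (f : U -> V) :
  continuous h -> (forall x, A (h x)) -> {within A, continuous f} ->
  continuous (f \o h).
Proof.
move=> ch Ah /subspace_continuousP cf x B nB.
have /ch : nbhs (h x) [set y | A y -> B (f y)] := cf _ (Ah x) _ nB.
by apply: (@filterS _ (nbhs x)) => y /=; apply; exact: Ah.
Qed.

(** The shift by pi measures f from the inner equator and absorbs the minus sign of the normal. *)
Lemma interior_unit_normal_torus_inner t f :
  interior_unit_normal solid_torus (torus_map t (f + pi) 1) =
  vec3 (cos t * cos f) (sin t * cos f) (sin f) :> E3.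
Proof.
by rewrite interior_unit_normal_torusE cosDpi sinDpi;
  apply: eq_vec3; rewrite !mxE /=; ring.
Qed.

(** Compactness of the square of angles gives a minimum; the explicit formula [DE] makes the chosen
    normal visibly continuous. *)
Lemma dot_normal_bounded_below C :
  {within torus, continuous C} ->
  (forall P, torus P -> 0 < dot (C P) (interior_unit_normal solid_torus P)) ->
  exists2 d : R, 0 < d &
    forall P, torus P -> d <= dot (C P) (interior_unit_normal solid_torus P).
Proof.
move=> cC Cnu; pose W (u : R * R) := C (torus_map u.1 u.2 1).
have cW i : continuous (fun u => W u ord0 i).
  have cCT : continuous W.
    by apply: (continuous_comp_within continuous_torus_map _ cC) => v;
      exact: torus_map_torus.
  by move=> u; exact: (continuous_comp (cCT u) (@coord_cvg R _ _ _)).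
pose D (u : R * R) :=
  dot (W u) (interior_unit_normal solid_torus (torus_map u.1 u.2 1)).
have DE u : D u = - (W u ord0 0 * (cos u.1 * cos u.2)
    + W u ord0 1 * (sin u.1 * cos u.2) + W u ord0 2 * sin u.2).
  by rewrite /D interior_unit_normal_torusE dotE !mxE /=; ring.
have cD : continuous D.
  have [cs sn] := (@continuous_cos R, @continuous_sin R).
  rewrite (funext DE) => u; apply: cvgN.
  apply: cvgD; [apply: cvgD|]; apply: cvgM; try exact: cW.
  - by apply: cvgM; [exact: continuous_comp_fst|exact: continuous_comp_snd].
  - by apply: cvgM; [exact: continuous_comp_fst|exact: continuous_comp_snd].
  - exact: continuous_comp_snd.
have pi2 : 0 <= 2 * pi :> R by rewrite mulr_ge0// pi_ge0.
have [|u _ Dmin] := compact_EVT_min _ (compact_setX (@segment_compact R 0 (2 * pi))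
    (@segment_compact R 0 (2 * pi))) (continuous_subspaceT cD).
  by exists (0, 0); split; rewrite /= in_itv /= lexx.
exists (D u); first by apply: Cnu; exact: torus_map_torus.
by move=> P [v vI <-]; apply: Dmin; rewrite inE.
Qed.

(** * Inward fields cover a band *)

Lemma band_sub_image_torus C :
  {within torus, continuous C} ->
  (forall P, torus P -> sphere (C P)) ->
  (forall P, torus P -> 0 < dot (C P) (interior_unit_normal solid_torus P)) ->
  exists delta : R, 0 < delta /\ band delta `<=` C @` torus.
Proof.
move=> cC Csph Cnu; have [d d0 dC] := dot_normal_bounded_below cC Cnu.
(* The bound [d] yields the boundary signs below; the bound 1 makes the horizontal length [s] of [n]
   positive, so that its longitude [al] exists. *)
exists (Num.min d 1); split=> [|n [nsph]]; first by rewrite lt_min d0 ltr01.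
have -> : dot n e3 = n ord0 2 by rewrite dotE !vec3E; ring.
rewrite lt_min => /andP[n3d n31].
move: nsph; rewrite /sphere /= dotE => nsph.
pose s := Num.sqrt (1 - n ord0 2 ^+ 2).
have s2 : s ^+ 2 = 1 - n ord0 2 ^+ 2.
  by rewrite sqr_sqrtr//; move: n31; rewrite ltr_norml => /andP[? ?]; nra.
have s0 : 0 < s.
  by rewrite sqrtr_gt0; move: n31; rewrite ltr_norml => /andP[? ?]; nra.
have [|al _ [ca sa]] := @polar_angle R (n ord0 0 / s) (n ord0 1 / s).
  rewrite !expr_div_n -mulrDl s2 (_ : _ + _ = 1 - n ord0 2 ^+ 2); last by rewrite -nsph; ring.
  by rewrite divff// -s2 expf_neq0// gt_eqF.
have n0E : n ord0 0 = s * cos al by rewrite -ca mulrC divfK// gt_eqF.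
have n1E : n ord0 1 = s * sin al by rewrite -sa mulrC divfK// gt_eqF.
(* Rescales [0, 1] to [-pi/2, pi/2], in both angles. *)
pose ang (x : R) := pi * x - pi / 2.
have ang0 : ang 0 = - (pi / 2) by rewrite /ang mulr0 add0r.
have ang1 : ang 1 = pi / 2 by rewrite /ang; lra.
pose W (u : R * R) := C (torus_map (al + ang u.1) (ang u.2 + pi) 1).
have Wd u : d <= W u ord0 0 * (cos (al + ang u.1) * cos (ang u.2))
    + W u ord0 1 * (sin (al + ang u.1) * cos (ang u.2))
    + W u ord0 2 * sin (ang u.2).
  have := dC _ (torus_map_torus (al + ang u.1) (ang u.2 + pi)).
  by rewrite interior_unit_normal_torus_inner dotE !vec3E.
have cang : continuous ang.
  move=> x; apply: cvgB; last exact: cvg_cst.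
  by apply: cvgM; [exact: cvg_cst|exact: cvg_id].
have cW i : continuous (fun u => W u ord0 i).
  have cCT : continuous (C \o (fun u : R * R => torus_map u.1 u.2 1)).
    by apply: (continuous_comp_within continuous_torus_map _ cC) => v;
      exact: torus_map_torus.
  have c1 : continuous (fun x => al + ang x).
    by move=> x; apply: cvgD; [exact: cvg_cst|exact: cang].
  have c2 : continuous (fun x => ang x + pi).
    by move=> x; apply: cvgD; [exact: cang|exact: cvg_cst].
  have ch : continuous (fun u : R * R => (al + ang u.1, ang u.2 + pi) : R * R).
    exact: (continuous_map_pair c1 c2).
  move=> u; have cWu := continuous_comp (ch u) (cCT _).
  exact: (continuous_comp cWu (@coord_cvg R _ _ _)).
pose F (u : R * R) := W u ord0 2 - n ord0 2.
(* On t = al -/+ pi/2 this is -/+ (C.nu - n3 sin f), where C.nu >= d > |n3 sin f|; the second term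
   drops out where [F] vanishes. *)
pose G (u : R * R) :=
  cos (ang u.2) * (W u ord0 1 * cos al - W u ord0 0 * sin al)
  + sin (ang u.1) * (sin (ang u.2) * F u).
have n3 : - d < n ord0 2 < d by rewrite -ltr_norml.
have cF : continuous F by move=> u; apply: cvgB; [exact: cW|exact: cvg_cst].
have cG : continuous G.
  have cc : continuous (fun x => cos (ang x)).
    by move=> x; apply: (continuous_comp (cang x)); exact: continuous_cos.
  have cs : continuous (fun x => sin (ang x)).
    by move=> x; apply: (continuous_comp (cang x)); exact: continuous_sin.
  move=> u; apply: cvgD; apply: cvgM.
  - exact: (continuous_comp_snd cc).
  - by apply: cvgB; (apply: cvgM; [exact: cW|exact: cvg_cst]).
  - exact: (continuous_comp_fst cs).
  - by apply: cvgM; [exact: (continuous_comp_snd cs)|exact: cF].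
have sn3 y : - d < sin y * n ord0 2 < d.
  rewrite -ltr_norml normrM (le_lt_trans _ n3d)// ler_piMl// ler_norml.
  by rewrite sin_geN1 sin_le1.
have [||||u [u1 u2 Fu Gu]] := poincare_miranda2 cF cG.
(* The normal is -e3 on f = -pi/2 and e3 on f = pi/2. *)
- move=> x _; have := Wd (x, 0); rewrite /F /= ang0.
  by rewrite cosN sinN cos_pihalf sin_pihalf; lra.
- move=> x _; have := Wd (x, 1); rewrite /F /= ang1.
  by rewrite cos_pihalf sin_pihalf; lra.
- move=> y _; have := Wd (0, y); have := sn3 (ang y).
  rewrite /G /F /= ang0 (cosBpihalf al) (sinBpihalf al) sinN sin_pihalf.
  set c := cos (ang y); set v := sin (ang y); nra.
- move=> y _; have := Wd (1, y); have := sn3 (ang y).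
  rewrite /G /F /= ang1 (cosDpihalf al) (sinDpihalf al) sin_pihalf.
  set c := cos (ang y); set v := sin (ang y); nra.
have W2 : W u ord0 2 = n ord0 2 by apply/eqP; rewrite -subr_eq0 -/(F u) Fu.
have := Wd u; rewrite W2 (cosD al) (sinD al) => dW.
have sn := sn3 (ang u.2).
pose a := W u ord0 0 * cos al + W u ord0 1 * sin al.
have Wu0 : W u ord0 1 * cos al - W u ord0 0 * sin al = 0.
  have := Gu; rewrite /G Fu !mulr0 addr0 => /eqP; rewrite mulf_eq0.
  (* If cos f = 0, then [dW] reads d <= n3 sin f, against [sn]. *)
  case/orP=> /eqP // c0; move: dW; rewrite c0; lra.
have W0 : W u ord0 0 = a * cos al.
  transitivity (W u ord0 0 * (cos al ^+ 2 + sin al ^+ 2)).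
    by rewrite cos2Dsin2 mulr1.
  transitivity (a * cos al - (W u ord0 1 * cos al - W u ord0 0 * sin al) * sin al).
    by rewrite /a; ring.
  by rewrite Wu0 mul0r subr0.
have W1 : W u ord0 1 = a * sin al.
  transitivity (W u ord0 1 * (cos al ^+ 2 + sin al ^+ 2)).
    by rewrite cos2Dsin2 mulr1.
  transitivity (a * sin al + (W u ord0 1 * cos al - W u ord0 0 * sin al) * cos al).
    by rewrite /a; ring.
  by rewrite Wu0 mul0r addr0.
have cos_ang x : 0 <= x <= 1 -> 0 <= cos (ang x).
  move=> /andP[x0 x1]; apply: cos_ge0_pihalf; have := @pi_ge0 R.
  by rewrite /ang => p0; apply/andP; split; nra.
(* Here C.nu = a cos(t - al) cos f + n3 sin f with both cosines nonnegative, so a <= 0 would give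
   C.nu < d. *)
have a0 : 0 < a.
  rewrite ltNge; apply/negP => a0; move: dW.
  have -> : W u ord0 0 * ((cos al * cos (ang u.1) - sin al * sin (ang u.1)) * cos (ang u.2))
      + W u ord0 1 * ((sin al * cos (ang u.1) + cos al * sin (ang u.1)) * cos (ang u.2))
    = a * (cos (ang u.1) * cos (ang u.2))
      + (W u ord0 1 * cos al - W u ord0 0 * sin al) * sin (ang u.1) * cos (ang u.2).
    by rewrite /a; ring.
  have := mulr_le0_ge0 a0 (mulr_ge0 (cos_ang _ u1) (cos_ang _ u2)).
  by rewrite Wu0 !mul0r; lra.
(* Unit vectors of equal height have horizontal parts of equal length, and [a] and [s] are both
   positive. *)
have aE : a = s.
  apply/eqP; rewrite -(eqrXn2 (n := 2))// ?ltW// s2.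
  have := Csph _ (torus_map_torus (al + ang u.1) (ang u.2 + pi)).
  rewrite /sphere /= dotE -/(W u) W0 W1 W2 => <-; apply/eqP.
  transitivity (a ^+ 2 * (cos al ^+ 2 + sin al ^+ 2)); last by ring.
  by rewrite cos2Dsin2 mulr1.
exists (torus_map (al + ang u.1) (ang u.2 + pi) 1); first exact: torus_map_torus.
by apply: eq_vec3; rewrite -/(W u) ?W0 ?W1 ?W2 ?aE ?n0E ?n1E.
Qed.

(** * An inward field with values in a thin band *)

Definition axis_dist P : R := Num.sqrt (P ord0 0 ^+ 2 + P ord0 1 ^+ 2).

(* - cos f e_r + a sin f e_t - b sin f e3 in Cartesian coordinates:
   on the torus cos f = r - 2, sin f = z, e_r = (x, y, 0) / r. *)
Definition twisted_field (a b : R) P : E3 :=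
  let r := axis_dist P in
  vec3 (((2 - r) * P ord0 0 - a * P ord0 2 * P ord0 1) / r)
       (((2 - r) * P ord0 1 + a * P ord0 2 * P ord0 0) / r)
       (- b * P ord0 2).

Lemma axis_dist_torus_map t f : axis_dist (torus_map t f 1) = 2 + cos f.
Proof.
rewrite /axis_dist !vec3E mul1r !exprMn -mulrDl cos2Dsin2 mul1r sqrtr_sqr.
by rewrite ger0_norm//; have := cos_geN1 f; lra.
Qed.

Lemma twisted_fieldE a b t f : twisted_field a b (torus_map t f 1) =
  vec3 (- cos f * cos t - a * sin f * sin t)
       (- cos f * sin t + a * sin f * cos t) (- b * sin f).
Proof.
have r0 : 2 + cos f != 0 by have := cos_geN1 f; lra.
by rewrite /twisted_field axis_dist_torus_map; apply: eq_vec3;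
  rewrite !vec3E /= !mul1r //; field.
Qed.

(* Stated for an arbitrary filter, as in core_dist2_cvg: with nbhs Q itself,
   unification unfolds the matrix topology. *)
Lemma twisted_field_cvg a b (F : set_system E3) (FF : Filter F) (Q : E3) :
  axis_dist Q != 0 -> (forall i, (fun P : E3 => P ord0 i) @ F --> Q ord0 i) ->
  twisted_field a b @ F --> twisted_field a b Q.
Proof.
move=> r0 c.
have sqr_cvg (g : E3 -> R) (l : R) :
    g @ F --> l -> (fun P => g P ^+ 2) @ F --> l ^+ 2.
  by move=> gl; exact: (cvgM gl gl).
have cxy : (fun P : E3 => P ord0 0 ^+ 2 + P ord0 1 ^+ 2) @ F -->
    Q ord0 0 ^+ 2 + Q ord0 1 ^+ 2.
  by apply: cvgD; apply: sqr_cvg; exact: c.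
have cr : axis_dist @ F --> axis_dist Q.
  exact: (cvg_comp _ _ cxy (@sqrt_continuous R _)).
have crV : (fun P => (axis_dist P)^-1) @ F --> (axis_dist Q)^-1 by exact: cvgV.
have c2r : (fun P => 2 - axis_dist P) @ F --> 2 - axis_dist Q.
  by apply: cvgB => //; exact: cvg_cst.
have caz : (fun P : E3 => a * P ord0 2) @ F --> a * Q ord0 2.
  by apply: cvgM; [exact: cvg_cst|exact: c].
apply: cvg_vec3.
- by apply: cvgM => //; apply: cvgB; apply: cvgM => //; exact: c.
- by apply: cvgM => //; apply: cvgD; apply: cvgM => //; exact: c.
- by apply: cvgM; [exact: cvg_cst|exact: c].
Qed.

(** The torus avoids the axis: [axis_dist] equals 2 + cos f >= 1 there, so the division is
    harmless. *)
Lemma twisted_field_continuous a b : {within torus, continuous (twisted_field a b)}.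
Proof.
apply: continuous_in_subspaceT => P; rewrite inE => -[[t f] _ <-].
apply: (@twisted_field_cvg _ _ (nbhs _) (nbhs_filter _)) => [|i].
  by rewrite axis_dist_torus_map; have := cos_geN1 f; lra.
exact: coord_cvg.
Qed.

Lemma sphere_twisted_field a b P : a ^+ 2 + b ^+ 2 = 1 -> torus P ->
  sphere (twisted_field a b P).
Proof.
move=> ab [[t f] _ <-]; rewrite twisted_fieldE /sphere /= dotE !vec3E.
transitivity (cos f ^+ 2 * (cos t ^+ 2 + sin t ^+ 2)
    + sin f ^+ 2 * (a ^+ 2 * (cos t ^+ 2 + sin t ^+ 2) + b ^+ 2)); first ring.
by rewrite cos2Dsin2 !mulr1 ab mulr1 cos2Dsin2.
Qed.

Lemma dot_twisted_field_normal a b t f :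
  dot (twisted_field a b (torus_map t f 1))
      (interior_unit_normal solid_torus (torus_map t f 1)) =
  cos f ^+ 2 + b * sin f ^+ 2.
Proof.
rewrite twisted_fieldE interior_unit_normal_torusE dotE !mxE /=.
transitivity (cos f ^+ 2 * (cos t ^+ 2 + sin t ^+ 2) + b * sin f ^+ 2); first ring.
by rewrite cos2Dsin2 mulr1.
Qed.

Lemma ex_field_in_band (gamma : R) : 0 < gamma ->
  exists C : E3 -> E3,
    [/\ {within torus, continuous C},
        forall P, torus P -> sphere (C P),
        forall P, torus P ->
          0 < dot (C P) (interior_unit_normal solid_torus P)
      & C @` torus `<=` band gamma].
Proof.
(* b > 0 makes cos^2 f + b sin^2 f positive, b < gamma bounds the height b |sin f|, and b < 1 gives
   a real [a] with a^2 + b^2 = 1. *)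
move=> g0; pose b := Num.min gamma 1 / 2.
have [b0 bg b1] : [/\ 0 < b, b < gamma & b < 1].
  rewrite /b; have [g1|g1] := lerP gamma 1; split; lra.
pose a := Num.sqrt (1 - b ^+ 2).
have ab : a ^+ 2 + b ^+ 2 = 1 by rewrite sqr_sqrtr ?subrK//; nra.
exists (twisted_field a b); split.
- exact: twisted_field_continuous.
- by move=> P; exact: sphere_twisted_field.
- move=> _ [[t f] _ <-]; rewrite dot_twisted_field_normal.
  by have := cos2Dsin2 f; have := sqr_ge0 (cos f); have := sqr_ge0 (sin f); nra.
- move=> _ [P TP <-]; split; first exact: sphere_twisted_field.
  case: TP => -[t f] _ <-; rewrite twisted_fieldE dotE !vec3E !mulr0 mulr1 !add0r.
  rewrite normrM normrN (gtr0_norm b0) (le_lt_trans _ bg)// ler_piMr ?(ltW b0)//.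
  by rewrite ler_norml sin_geN1 sin_le1.
Qed.

End TorusFields.

Theorem proposition6p1 (R : realType) :
  (forall C : 'rV[R]_3 -> 'rV[R]_3,
      {within torus, continuous C} ->
      (forall P, torus P -> sphere (C P)) ->
      (forall P, torus P -> 0 < dot (C P) (interior_unit_normal solid_torus P)) ->
      exists delta : R, 0 < delta /\ band delta `<=` C @` torus) /\
  (forall gamma : R, 0 < gamma ->
      exists C : 'rV[R]_3 -> 'rV[R]_3,
        [/\ {within torus, continuous C},
            forall P, torus P -> sphere (C P),
            forall P, torus P ->
              0 < dot (C P) (interior_unit_normal solid_torus P)
          & C @` torus `<=` band gamma]).
Proof.
split=> [C|gamma]; [exact: band_sub_image_torus|exact: ex_field_in_band].
Qed.
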